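(* Let $p\in(0,1)$, $q=1-p$, and let $D\sim\mathcal D_p$. For any graph $G$ with $n$ nodes and average degree $d$ (an integer), the expected matching loss satisfies $$L(G)\ \ge\ \max\left\{npq^d-\frac12\left(1-(1-2p)^n\right),\ \ \frac12\,npq^d\left(1-(1-2p)^{n-d-1}\right)\right\}.$$
   Context: $G=([n],E)$ is a simple undirected graph with average degree $d=2|E|/n$. Under $\mathcal D_p$, the demands $D_j$, $j\in[n]$, are independent, each equal to $1/2$ with probability $p$ and $1$ with probability $q=1-p$. Let $\mathrm{supp}(D)=\{j:D_j=1/2\}$ and let $G[\mathrm{supp}(D)]$ be the subgraph induced by these nodes. For a graph $H$, $\mu(H)$ is its maximum matching size. With $K_n$ the complete graph on $[n]$, define $$L(G,D)=2\bigl(\mu(K_n[\mathrm{supp}(D)])-\mu(G[\mathrm{supp}(D)])\bigr),\qquad L(G)=\mathbb E_{D\sim\mathcal D_p}[L(G,D)].$$ The convention $0^0=1$ is used. *)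

(* Defs.v *)
From HB Require Import structures.
From mathcomp Require Import all_boot all_order all_algebra.
From mathcomp Require Import all_classical all_reals all_analysis.

Set Implicit Arguments.
Unset Strict Implicit.
Unset Printing Implicit Defensive.

Import Order.TTheory GRing.Theory Num.Theory.
Local Open Scope ring_scope.

Record sgraph (V : finType) := SGraph {
  adj :> rel V;
  adj_sym : symmetric adj;
  adj_irr : irreflexive adj }.

Section Graphs.
Variable V : finType.
Implicit Types (G : sgraph V) (S : {set V}).

Definition edges G : {set {set V}} :=
  [set [set e.1; e.2]%SET | e in [pred e : V * V | adj G e.1 e.2]]%SET.

(* A matching is a set of pairwise disjoint edges. *)
Definition is_matching G (M : {set {set V}}) : bool :=
  (M \subset edges G) && finset.trivIset M.

Definition matching_number G : nat :=
  \max_(M : {set {set V}} | is_matching G M) #|M|.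

Definition avg_degree (R : realType) G : R :=
  (2 * #|edges G|)%:R / #|V|%:R.

Lemma complete_sym : symmetric (fun x y : V => x != y).
Proof. by move=> x y; rewrite eq_sym. Qed.

Lemma complete_irr : irreflexive (fun x y : V => x != y).
Proof. by move=> x; rewrite eqxx. Qed.

Definition complete : sgraph V := SGraph complete_sym complete_irr.

Lemma induced_sym G S : symmetric (fun x y : {x : V | x \in S} => G (val x) (val y)).
Proof. by move=> x y; rewrite adj_sym. Qed.

Lemma induced_irr G S :
  irreflexive (fun x y : {x : V | x \in S} => G (val x) (val y)).
Proof. by move=> x; rewrite adj_irr. Qed.

Definition induced G S : sgraph {x : V | x \in S} :=
  SGraph (@induced_sym G S) (@induced_irr G S).

End Graphs.

Section Loss.
Variables (R : realType) (n : nat).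

Definition supp (D : 'I_n -> R) : {set 'I_n} := [set j | D j == 2^-1]%SET.

Definition matching_loss (G : sgraph 'I_n) (D : 'I_n -> R) : R :=
  2 * ((matching_number (induced (complete 'I_n) (supp D)))%:R
       - (matching_number (induced G (supp D)))%:R).

End Loss.

Definition independent_RVs (disp : measure_display) (T : measurableType disp)
    (R : realType) (P : probability T R) (I : finType)
    (X : I -> {RV P >-> R}) : Prop :=
  forall (J : {set I}) (A : I -> set R), (forall j, measurable (A j)) ->
    (P (\bigcap_(j in [set` J]) (X j @^-1` A j))%classic
     = \prod_(j in J) P (X j @^-1` A j)%classic)%E.

Section RandomDemands.
Variables (disp : measure_display) (T : measurableType disp).
Variables (R : realType) (P : probability T R) (n : nat).
Variable D : 'I_n -> {RV P >-> R}.

(* The random vector D has law D_p. *)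
Definition demand_law (p : R) : Prop :=
  independent_RVs D /\
  forall j, P [set w | D j w = 2^-1]%classic = p%:E /\
            P [set w | D j w = 1]%classic = (1 - p)%:E.

Definition expected_loss (G : sgraph 'I_n) : \bar R :=
  ('E_P[fun w => matching_loss G (fun j => D j w)])%E.

End RandomDemands.

(* Main.v *)
Require Import Defs.
From HB Require Import structures.
From mathcomp Require Import all_boot all_order all_algebra.
From mathcomp Require Import all_classical all_reals all_analysis.
From mathcomp Require Import zify ring lra.

Set Implicit Arguments.
Unset Strict Implicit.
Unset Printing Implicit Defensive.

Import Order.TTheory GRing.Theory Num.Theory.
Local Open Scope ring_scope.

(* Let S be the support, I the number of isolated nodes of G[S], and mu the
   matching number. Matchings cover no isolated node, so 2 mu(G[S]) <= |S| - I, while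
   2 mu(K_n[S]) is |S| rounded down to an even number. Hence the loss is at
   least I - [|S| odd], and at least I when |S| is even. Writing the parity
   of |S| with (-1)^|S|, the expectations of both lower bounds split into
   products over the nodes: a node of degree x contributes p q^x to the first
   and p q^x (1 - r^(n-1-x)) / 2 to the second, with r = 1 - 2p. Both are convex
   in the integer x, and Jensen's inequality replaces the degrees by d. *)

(** * Matchings and isolated nodes *)

Section Matchings.
Local Open Scope set_scope.
Local Open Scope nat_scope.
Variables (V : finType) (G : sgraph V).

Definition neighbours (x : V) : {set V} := [set y | G x y].

Definition isolated : {set V} := [set x | neighbours x == finset.set0].

Lemma edgesP (e : {set V}) :
  reflect (exists x y, G x y /\ e = [set x; y]) (e \in edges G).
Proof.
apply: (iffP imsetP) => [[[x y] xy ->]|[x [y [xy ->]]]]; first by exists x, y.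
by exists (x, y).
Qed.

Lemma card_edge (e : {set V}) : e \in edges G -> #|e| = 2.
Proof.
case/edgesP => x [y [xy ->]]; rewrite cards2.
by case: eqP xy => // ->; rewrite adj_irr.
Qed.

(** Double counting of incidences: the neighbours of [x] are in bijection with the edges through
    [x], and each edge has two ends. *)
Lemma sum_card_neighbours : \sum_x #|neighbours x| = 2 * #|edges G|.
Proof.
have card_nb x : #|neighbours x| = #|[set e in edges G | x \in e]|.
  have inj : {in neighbours x &, injective (fun y => [set x; y])}.
    move=> y z; rewrite !inE => xy xz /setP/(_ y).
    rewrite !inE eqxx orbT; case: (y =P x) xy => [->|_ _ /esym/eqP//].
    by rewrite adj_irr.
  rewrite -(card_in_imset inj); apply: eq_card => e; rewrite inE.
  apply/imsetP/andP => [[y]|[/edgesP[a [b [ab ->]]]]].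
    rewrite inE => xy ->; split; last by rewrite !inE eqxx.
    by apply/edgesP; exists x, y.
  rewrite !inE => /orP[]/eqP ->; first by exists b; rewrite // inE.
  by exists a; rewrite ?inE 1?adj_sym // finset.setUC.
rewrite (eq_bigr (fun x => \sum_(e in edges G | x \in e) 1)); last first.
  by move=> x _; rewrite card_nb -sum1_card; apply: eq_bigl => e; rewrite inE.
rewrite (exchange_big_dep (mem (edges G))) //=; last by move=> i j _ /andP[].
rewrite (eq_bigr (fun=> 2)); first by rewrite sum_nat_const mulnC.
move=> e eG; rewrite -(card_edge eG) -sum1_card.
by apply: eq_bigl => x; rewrite eG.
Qed.

Lemma card_cover_matching (M : {set {set V}}) :
  is_matching G M -> #|finset.cover M| = 2 * #|M|.
Proof.
case/andP => /fintype.subsetP ME; rewrite /finset.trivIset => /eqP <-.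
rewrite mulnC -sum_nat_const; apply: eq_bigr => e /ME; exact: card_edge.
Qed.

(** A matching covers twice as many nodes as it has edges, and none of the covered nodes is
    isolated. *)
Lemma matching_number_isolated :
  2 * matching_number G + #|isolated| <= #|V|.
Proof.
have bound M : is_matching G M -> 2 * #|M| + #|isolated| <= #|V|.
  move=> mM; rewrite -(card_cover_matching mM) -cardsUI.
  rewrite [X in _ + #|pred_of_set X|](_ : _ = finset.set0);
    first by rewrite cards0 addn0 max_card.
  apply/setP => x; rewrite !inE; apply/negP => /andP[/finset.bigcupP[e eM xe]].
  case/andP: mM => /fintype.subsetP/(_ _ eM)/edgesP[a [b [ab eE]]] _ /eqP/setP iso.
  move: xe; rewrite eE !inE => /orP[]/eqP xE.
    by move: (iso b); rewrite !inE xE ab.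
  by move: (iso a); rewrite !inE xE adj_sym ab.
have [|M mM maxM] := @eq_bigmax_cond _ [pred M | is_matching G M]
    (fun M : {set {set V}} => #|M|).
  apply/card_gt0P; exists finset.set0; rewrite inE /is_matching finset.sub0set.
  by apply/finset.trivIsetP => A B; rewrite inE.
by rewrite /matching_number maxM bound.
Qed.

(** A matching can be grown edge by edge: while its size is below [#|V|./2], two nodes remain
    uncovered, and they are adjacent. *)
Lemma matching_number_complete :
  (forall x y, x != y -> G x y) -> #|V|./2 <= matching_number G.
Proof.
move=> complG.
have matching k : 2 * k <= #|V| -> exists2 M, is_matching G M & #|M| = k.
  elim: k => [_|k IHk k_le].
    exists finset.set0; rewrite ?cards0 // /is_matching finset.sub0set.
    by apply/finset.trivIsetP => A B; rewrite inE.
  have [|M mM cardM] := IHk; first by lia.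
  have : 1 < #|~: finset.cover M|.
    by move: (cardsC (finset.cover M)); rewrite (card_cover_matching mM); lia.
  case/card_gt1P => x [y]; rewrite !inE => -[xM yM xy].
  (* [trivIsetU1] requires this to conclude that the new edge is not already in [M], so that the
     size does grow. *)
  have M0 : finset.set0 \notin M.
    apply/negP => /(fintype.subsetP (proj1 (andP mM)))/card_edge.
    by rewrite cards0.
  have disj : {in M, forall B : {set V}, [disjoint [set x; y] & B]}.
    move=> B BM; rewrite -setI_eq0; apply/eqP/setP => z; rewrite !inE.
    apply/negP => /andP[/orP[]/eqP -> zB].
      by move/negP: xM; apply; apply/finset.bigcupP; exists B.
    by move/negP: yM; apply; apply/finset.bigcupP; exists B.
  have [ME tM] := andP mM; have [tM' eM] := trivIsetU1 disj tM M0.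
  exists ([set x; y] |: M); last by rewrite cardsU1 eM cardM.
  rewrite /is_matching tM' andbT finset.subUset ME andbT finset.sub1set.
  by apply/edgesP; exists x, y; split=> //; exact: complG.
have [|M mM <-] := matching #|V|./2; first by lia.
exact: (@leq_bigmax_cond _ (is_matching G) (fun M : {set {set V}} => #|M|)).
Qed.

End Matchings.

(** * Lower bounds on the loss for a fixed support *)

Section InducedLoss.
Local Open Scope set_scope.
Variables (R : realFieldType) (V : finType) (G : sgraph V).
Implicit Types (S : {set V}).

(** Stated in [V] rather than in the subtype of [S], so that membership factors over the nodes of
    [V]. *)
Definition isolated_in S : {set V} :=
  [set x in S | [disjoint neighbours G x & S]].

Lemma card_isolated_induced S :
  #|isolated (Defs.induced G S)| = #|isolated_in S|.
Proof.
rewrite -(card_imset _ val_inj); apply: eq_card => x; rewrite inE.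
apply/imsetP/andP => [[y + ->]|[xS /pred0P xN]].
  rewrite inE => /eqP/setP yN; split; first exact: valP.
  apply/pred0P => z /=; apply/negP; rewrite inE => /andP[yz zS].
  by move: (yN (exist _ z zS)); rewrite !inE /= yz.
exists (exist _ x xS) => //.
rewrite inE; apply/eqP/setP => y; rewrite !inE /=.
by move: (xN (val y)); rewrite /= inE (valP y) andbT.
Qed.

Definition support_loss S : R :=
  2 * ((matching_number (Defs.induced (complete V) S))%:R
       - (matching_number (Defs.induced G S))%:R).

Lemma matching_numbers_induced S :
  (#|S|./2 <= matching_number (Defs.induced (complete V) S))%N /\
  (2 * matching_number (Defs.induced G S) + #|isolated_in S| <= #|S|)%N.
Proof.
have cardS : #|{: {x | x \in S}}| = #|S| by rewrite card_sig.
split; rewrite -cardS; first by apply: matching_number_complete => x y.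
by rewrite -card_isolated_induced; exact: matching_number_isolated.
Qed.

(** The subtracted term is the indicator of odd [#|S|], the price of rounding in [#|S|./2]. *)
Lemma support_loss_ge S :
  #|isolated_in S|%:R - 2^-1 * (1 - (-1) ^+ #|S|) <= support_loss S.
Proof.
have [] := matching_numbers_induced S.
rewrite /support_loss -signr_odd; set a := matching_number _.
set b := matching_number _; set k := #|isolated_in S| => aS bS.
have : (k + 2 * b <= 2 * a + odd #|S|)%N by lia.
rewrite -(ler_nat R) !(natrD, natrM); case: (odd _) => /=; lra.
Qed.

(** Half of [1 + (-1) ^+ #|S|] is the indicator of even [#|S|], where rounding costs nothing; for
    odd [#|S|] the claim is only that the loss is nonnegative. *)
Lemma support_loss_ge_even S :
  2^-1 * (#|isolated_in S|%:R * (1 + (-1) ^+ #|S|)) <= support_loss S.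
Proof.
have [] := matching_numbers_induced S.
rewrite /support_loss -signr_odd; set a := matching_number _.
set b := matching_number _; set k := #|isolated_in S| => aS bS.
have : (~~ odd #|S| * k + 2 * b <= 2 * a)%N.
  by case: odd (odd_double_half #|S|) => /=; lia.
rewrite -(ler_nat R) !(natrD, natrM); case: (odd _) => /=; lra.
Qed.

End InducedLoss.

(** * Generating functions of a random support *)

Section RandomSupport.
Local Open Scope set_scope.
Variables (R : realFieldType) (V : finType) (G : sgraph V) (p q : R).
Implicit Types (S : {set V}) (t : R).

Definition support_prob S : R := \prod_i (if i \in S then p else q).

Lemma exprE_card t S : t ^+ #|S| = \prod_i (if i \in S then t else 1).
Proof. by rewrite -big_mkcond /= prodr_const. Qed.

(** Distribute the product of [p * t + q] over the nodes. At [t = 1] this is the total mass, at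
    [t = -1] the mean of the parity sign. *)
Lemma sum_expr_card t : \sum_S support_prob S * t ^+ #|S| = (p * t + q) ^+ #|V|.
Proof.
rewrite -prodr_const bigA_distr; apply: eq_bigr => S _.
rewrite exprE_card -big_split; apply: eq_bigr => i _ /=.
by case: ifP; rewrite ?mulr1.
Qed.

(** Isolation of [x] means that [x] is in [S] and its neighbours are not, a condition node by node:
    [x] contributes [p * t], a neighbour [q], any other node [p * t + q]. *)
Lemma sum_isolated_in t x :
  \sum_S support_prob S * t ^+ #|S| * (x \in isolated_in G S)%:R =
  p * t * q ^+ #|neighbours G x|
    * (p * t + q) ^+ (#|V| - #|neighbours G x| - 1).
Proof.
(* [f i] and [g i] weigh [i] inside and outside [S]; they vanish for a neighbour placed inside and
   for [x] placed outside. *)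
pose f i : R := p * t * (i \notin neighbours G x)%:R.
pose g i : R := q * (i != x)%:R.
transitivity (\prod_i (f i + g i)).
  rewrite bigA_distr; apply: eq_bigr => S _.
  rewrite exprE_card.
  have -> : (x \in isolated_in G S)%:R = \prod_i
      (if i \in S then (i \notin neighbours G x)%:R else (i != x)%:R : R).
    rewrite inE; have [/andP[xS /pred0P xN]|] := boolP (_ && _).
      rewrite big1 // => i _; case: ifP => iS.
        by move: (xN i); rewrite /= iS andbT => ->.
      by case: eqP iS => // ->; rewrite xS.
    rewrite negb_and; case: (boolP (x \in S)) => /= [xS|xS _].
      by case/pred0Pn => i /andP[/= iN iS]; rewrite (bigD1 i) //= iS iN mul0r.
    by rewrite (bigD1 x) //= (negbTE xS) eqxx mul0r.
  rewrite -!big_split; apply: eq_bigr => i _ /=.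
  by rewrite /f /g; case: ifP; rewrite ?mulr1.
have xN : x \notin neighbours G x by rewrite inE adj_irr.
rewrite (bigD1 x) //= {1}/f {1}/g xN eqxx mulr0 addr0 mulr1 -mulrA; congr (_ * _).
rewrite (bigID (mem (neighbours G x))) /=; congr (_ * _).
  rewrite -prodr_const; apply: eq_big => [i|i /andP[ix iN]].
    by case: eqP => // ->; rewrite (negbTE xN).
  by rewrite /f /g ix iN mulr0 add0r mulr1.
rewrite (eq_bigr (fun=> p * t + q)); last first.
  by move=> i /andP[ix iN]; rewrite /f /g ix iN !mulr1.
rewrite (eq_bigl (mem (~: (x |: neighbours G x)))); last first.
  by move=> i; rewrite !inE negb_or.
rewrite prodr_const; congr (_ ^+ _).
by rewrite [LHS]cardsCs finset.setCK cardsU1 xN add1n subn1 subnS.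
Qed.

Lemma sum_card_isolated_in t :
  \sum_S support_prob S * t ^+ #|S| * #|isolated_in G S|%:R =
  \sum_x p * t * q ^+ #|neighbours G x|
      * (p * t + q) ^+ (#|V| - #|neighbours G x| - 1).
Proof.
transitivity (\sum_S \sum_x
    support_prob S * t ^+ #|S| * (x \in isolated_in G S)%:R).
  apply: eq_bigr => S _; rewrite -mulr_sumr; congr (_ * _).
  rewrite -sum1_card natr_sum big_mkcond; apply: eq_bigr => x _.
  by case: (x \in _).
by rewrite exchange_big; apply: eq_bigr => x _; exact: sum_isolated_in.
Qed.

Lemma support_prob_ge0 S : 0 <= p -> 0 <= q -> 0 <= support_prob S.
Proof. by move=> p0 q0; apply: prodr_ge0 => i _; case: ifP. Qed.

End RandomSupport.

(** * Convexity and Jensen's inequality on the naturals *)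

Section DegreeConvexity.
Variable R : realFieldType.

(** Slopes are nondecreasing, so the forward slope at [m] bounds those to its right from below and
    those to its left from above. *)
Lemma convex_tangent_line (f : nat -> R) (m n : nat) :
  (forall k, f k.+1 - f k <= f k.+2 - f k.+1) ->
  f m + (f m.+1 - f m) * (n%:R - m%:R) <= f n.
Proof.
move=> fconv.
have slope_mono i j : (i <= j)%N -> f i.+1 - f i <= f j.+1 - f j.
  elim: j => [|j IHj]; first by rewrite leqn0 => /eqP ->.
  rewrite leq_eqVlt ltnS => /predU1P[->//|/IHj/le_trans]; apply; exact: fconv.
have [mn|/ltnW nm] := leqP m n.
  rewrite -natrB // -{2}(subnKC mn); elim: (n - m)%N => [|k IHk].
    by rewrite addn0 mulr0 addr0.
  have := IHk; have := slope_mono m (m + k)%N (leq_addr _ _).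
  by rewrite addnS -natr1; lra.
rewrite -(opprB m%:R) -natrB //.
have [k mE] : exists k, m = (n + k)%N by exists (m - n)%N; rewrite subnKC.
rewrite mE addKn; set c := f _ - _.
(* To the left of [m] the induction climbs from [n], each step having slope at most [c]. *)
have {nm} : forall i, (i <= k)%N -> f (n + i)%N <= f n + c * i%:R.
  elim=> [_|i IHi ik]; first by rewrite addn0 mulr0 addr0.
  have := IHi (ltnW ik); have : f (n + i).+1 - f (n + i)%N <= c.
    by apply: slope_mono; rewrite leq_add2l ltnW.
  by rewrite addnS -natr1; lra.
by move=> /(_ k (leqnn _)); lra.
Qed.

(** Sum the tangent lines at [m]: the linear parts cancel because [m] is the mean of [y]. *)
Lemma convex_jensen_nat (V : finType) (f : nat -> R) (y : V -> nat) (m : nat) :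
  (forall k, f k.+1 - f k <= f k.+2 - f k.+1) ->
  (\sum_i y i = #|V| * m)%N -> #|V|%:R * f m <= \sum_i f (y i).
Proof.
move=> fconv ysum.
apply: (@le_trans _ _ (\sum_i (f m + (f m.+1 - f m) * ((y i)%:R - m%:R)))).
  rewrite big_split /= -mulr_sumr sumrB -natr_sum ysum !sumr_const.
  by rewrite natrM mulr_natl mulr_natl subrr mulr0 addr0.
by apply: ler_sum => i _; exact: convex_tangent_line.
Qed.

(** The second difference is [q ^+ k * (q - 1) ^+ 2]. *)
Lemma exprn_convex (q : R) (k : nat) :
  0 <= q -> q ^+ k.+1 - q ^+ k <= q ^+ k.+2 - q ^+ k.+1.
Proof.
move=> q0; rewrite -subr_ge0 !exprS.
rewrite (_ : _ - _ = q ^+ k * (q - 1) ^+ 2); last by ring.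
by rewrite mulr_ge0 ?sqr_ge0 ?exprn_ge0.
Qed.

(* The bases satisfy [1 - (2 - a) = a - 1], so that the second difference at [k]
   is [(a - 1) ^ 2 * (a ^ k - (2 - a) ^ k)]. *)
Lemma subr_exprn_convex (a : R) (f := fun k => a ^+ k - (2 - a) ^+ k) (k : nat) :
  1 <= a -> f k.+1 - f k <= f k.+2 - f k.+1.
Proof.
move=> a1; rewrite /f -subr_ge0 !exprS.
rewrite (_ : _ - _ = (a - 1) ^+ 2 * (a ^+ k - (2 - a) ^+ k)); last by ring.
rewrite mulr_ge0 ?sqr_ge0 // subr_ge0 (le_trans (ler_norm _)) // normrX.
by rewrite lerXn2r ?nnegrE ?normr_ge0 ?ler_norml //; lra.
Qed.

Lemma sum_exprn_ge (V : finType) (q : R) (x : V -> nat) (d : nat) :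
  0 <= q -> (\sum_i x i = #|V| * d)%N ->
  #|V|%:R * q ^+ d <= \sum_i q ^+ x i.
Proof.
move=> q0; apply: (@convex_jensen_nat _ (fun k => q ^+ k)) => k.
exact: exprn_convex.
Qed.

Lemma sum_exprn_parity_ge (V : finType) (q : R) (x : V -> nat) (N d : nat) :
  0 < q <= 1 -> (forall i, (x i <= N)%N) -> (d <= N)%N ->
  (\sum_i x i = #|V| * d)%N ->
  #|V|%:R * (q ^+ d * (1 - (2 * q - 1) ^+ (N - d))) <=
  \sum_i q ^+ x i * (1 - (2 * q - 1) ^+ (N - x i)).
Proof.
move=> /andP[q0 q1] xN dN xsum.
have qneq0 : q != 0 by rewrite gt_eqF.
(* Substituting [y = N - k] turns each term into a multiple of
   [a ^ y - (2 - a) ^ y] with [a = 1 / q]. *)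
have termE k : (k <= N)%N -> q ^+ k * (1 - (2 * q - 1) ^+ (N - k)) =
    q ^+ N * (q^-1 ^+ (N - k) - (2 - q^-1) ^+ (N - k)).
  (* Split [q ^+ N] as [q ^+ k * q ^+ (N - k)] and use [q * (2 - q^-1) = 2 * q - 1]. *)
  move=> kN; rewrite -{2}(subnKC kN) exprD -mulrA; congr (_ * _).
  rewrite mulrBr -!exprMn mulfV // expr1n mulrBr mulfV //.
  by rewrite (mulrC q 2).
rewrite termE // (eq_bigr _ (fun i _ => termE _ (xN i))) -mulr_sumr mulrCA.
rewrite ler_wpM2l ?exprn_ge0 ?(ltW q0) //.
apply: (@convex_jensen_nat _ (fun k => q^-1 ^+ k - (2 - q^-1) ^+ k)
  (fun i => N - x i)%N).
  by move=> k; apply: subr_exprn_convex; rewrite invf_ge1.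
(* Since each [x i] is at most [N], no subtraction is truncated and the mean of [N - x i] is
   [N - d]. *)
rewrite sumnB // xsum sum_nat_const mulnBr.
by rewrite (eq_card (_ : _ =i V)).
Qed.

End DegreeConvexity.

(** * Mean degree and the two bounds for the random support *)

Lemma sum_card_neighbours_avg (V : finType) (R : realType) (G : sgraph V) (d : nat) :
  (0 < #|V|)%N -> avg_degree R G = d%:R ->
  (\sum_x #|neighbours G x| = #|V| * d)%N.
Proof.
move=> V0; rewrite /avg_degree sum_card_neighbours => dE.
apply/eqP; rewrite -(eqr_nat R) [eqbRHS]natrM -dE mulrC divfK //.
by rewrite pnatr_eq0 -lt0n.
Qed.

Lemma card_neighbours_lt (V : finType) (G : sgraph V) (x : V) :
  (#|neighbours G x| < #|V|)%N.
Proof.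
rewrite -cardsT proper_card // properT; apply/eqP => /setP/(_ x).
by rewrite !inE adj_irr.
Qed.

Section ExpectedSupportLoss.
Variables (R : realType) (V : finType) (G : sgraph V) (p q : R) (d : nat).
Hypotheses (V_gt0 : (0 < #|V|)%N) (p01 : 0 < p < 1) (qE : q = 1 - p).
Hypothesis degE : avg_degree R G = d%:R.

Let p_ge0 : 0 <= p. Proof. by case/andP: p01 => /ltW. Qed.

Let q_gt0 : 0 < q. Proof. by case/andP: p01 => _; rewrite qE subr_gt0. Qed.

Let sum_iso : \sum_(S : {set V}) support_prob p q S * #|isolated_in G S|%:R =
  p * \sum_x q ^+ #|neighbours G x|.
Proof.
transitivity (\sum_(S : {set V})
    support_prob p q S * 1 ^+ #|S| * #|isolated_in G S|%:R).
  by apply: eq_bigr => S _; rewrite expr1n mulr1.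
rewrite sum_card_isolated_in mulr_sumr; apply: eq_bigr => x _.
by rewrite qE (_ : p * 1 + (1 - p) = 1) ?expr1n ?mulr1 //; ring.
Qed.

Lemma sum_support_loss_ge :
  #|V|%:R * p * q ^+ d - 2^-1 * (1 - (1 - 2 * p) ^+ #|V|)
    <= \sum_(S : {set V}) support_prob p q S * support_loss R G S.
Proof.
pose low (S : {set V}) : R := #|isolated_in G S|%:R - 2^-1 * (1 - (-1) ^+ #|S|).
apply: (@le_trans _ _ (\sum_(S : {set V}) support_prob p q S * low S)); last first.
  apply: ler_sum => S _; apply: ler_wpM2l (support_loss_ge R G S).
  by apply: support_prob_ge0 => //; exact: ltW.
have -> : \sum_(S : {set V}) support_prob p q S * low S =
    \sum_(S : {set V}) support_prob p q S * #|isolated_in G S|%:R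
    - 2^-1 * (\sum_(S : {set V}) support_prob p q S * 1 ^+ #|S|
              - \sum_(S : {set V}) support_prob p q S * (-1) ^+ #|S|).
  rewrite -sumrB mulr_sumr -sumrB; apply: eq_bigr => S _.
  by rewrite /low expr1n; ring.
rewrite sum_iso !sum_expr_card.
have -> : p * 1 + q = 1 by rewrite qE; ring.
have -> : p * -1 + q = 1 - 2 * p by rewrite qE; ring.
rewrite expr1n lerB // (mulrC _ p) -mulrA ler_wpM2l //.
by apply: sum_exprn_ge (sum_card_neighbours_avg V_gt0 degE); exact: ltW.
Qed.

(** Averaging [support_loss_ge_even] combines the isolated-node sums at [t = 1] and [t = -1]; the
    latter carries the minus sign because [p * t] is then [- p]. *)
Lemma sum_support_loss_parity_ge :
  2^-1 * (#|V|%:R * p * q ^+ d) * (1 - (1 - 2 * p) ^+ (#|V| - d - 1))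
    <= \sum_(S : {set V}) support_prob p q S * support_loss R G S.
Proof.
pose low (S : {set V}) : R :=
  2^-1 * (#|isolated_in G S|%:R * (1 + (-1) ^+ #|S|)).
apply: (@le_trans _ _ (\sum_(S : {set V}) support_prob p q S * low S)); last first.
  apply: ler_sum => S _; apply: ler_wpM2l (support_loss_ge_even R G S).
  by apply: support_prob_ge0 => //; exact: ltW.
have -> : \sum_(S : {set V}) support_prob p q S * low S =
    2^-1 * (\sum_(S : {set V}) support_prob p q S * #|isolated_in G S|%:R
      + \sum_(S : {set V})
          support_prob p q S * (-1) ^+ #|S| * #|isolated_in G S|%:R).
  rewrite -big_split mulr_sumr; apply: eq_bigr => S _ /=.
  by rewrite /low; ring.
have deg_sum := sum_card_neighbours_avg V_gt0 degE.
have deg_le x : (#|neighbours G x| <= #|V|.-1)%N.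
  by rewrite -ltnS prednK // card_neighbours_lt.
(* The mean of the degrees is at most their common bound, so [#|V| - d - 1] is not truncated. *)
have d_le : (d <= #|V|.-1)%N.
  by rewrite -(leq_pmul2l V_gt0) -deg_sum -sum_nat_const leq_sum.
have predB k : (#|V| - k - 1 = #|V|.-1 - k)%N by lia.
have q01 : 0 < q <= 1 by rewrite q_gt0 qE gerBl.
have rE : 2 * q - 1 = 1 - 2 * p by rewrite qE; ring.
have := sum_exprn_parity_ge q01 deg_le d_le deg_sum.
rewrite sum_iso sum_card_isolated_in mulr_sumr -big_split /= rE => parity_ge.
rewrite (eq_bigr (fun x => p * (q ^+ #|neighbours G x|
    * (1 - (1 - 2 * p) ^+ (#|V|.-1 - #|neighbours G x|))))); last first.
  move=> x _; rewrite predB (_ : p * -1 + q = 1 - 2 * p); first by ring.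
  by rewrite -rE qE; ring.
rewrite -mulr_sumr predB -mulrA ler_pM2l ?invr_gt0 //.
by rewrite (mulrC _ p) -!mulrA ler_wpM2l.
Qed.

End ExpectedSupportLoss.

(** * Law of the support under the demand distribution *)

Section SupportLaw.
Variables (disp : measure_display) (T : measurableType disp).
Variables (R : realType) (P : probability T R) (n : nat).
Variables (D : 'I_n -> {RV P >-> R}) (p : R).
Hypothesis lawD : demand_law D p.

Definition support_event (S : {set 'I_n}) : set T :=
  [set w | supp (fun j => D j w) = S]%classic.

(** Taking the complement of [2^-1], rather than the value [1], makes the support event exactly an
    intersection, with no null set to discard. *)
Let target (S : {set 'I_n}) (j : 'I_n) : set R :=
  (if j \in S then [set 2^-1] else ~` [set 2^-1])%classic.

Let measurable_target S j : measurable (target S j).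
Proof.
by rewrite /target; case: ifP => _; [|apply: measurableC]; exact: measurable_set1.
Qed.

Let support_eventE (S : {set 'I_n}) :
  support_event S =
  (\bigcap_(j in [set` [set: 'I_n]%SET]) D j @^-1` target S j)%classic.
Proof.
apply/seteqP; split => w /=.
  move=> <- j _; rewrite /target /= inE; case: eqP => //.
move=> DS; apply/setP => j; rewrite inE.
have /= := DS j; rewrite /target inE => /(_ isT).
by case: ifP => _ /eqP // /negbTE.
Qed.

Lemma measurable_support_event S : measurable (support_event S).
Proof.
rewrite support_eventE; apply: fin_bigcap_measurable => // j _.
by apply: measurable_funPTI; exact: measurable_target.
Qed.

Lemma probability_support_event S :
  P (support_event S) = (support_prob p (1 - p) S)%:E.
Proof.
have [indepD PD] := lawD.
rewrite support_eventE indepD // /support_prob -prodEFin.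
rewrite (eq_bigl xpredT); last by move=> j; rewrite inE.
apply: eq_bigr => j _; have [PDj _] := PD j.
rewrite /target; case: ifP => _; first exact: PDj.
by rewrite -preimage_setC probability_setC ?PDj.
Qed.

(** The support takes finitely many values, so the integrand is a finite combination of indicators
    of support events. *)
Lemma expectation_support (phi : {set 'I_n} -> R) :
  ('E_P[fun w => phi (supp (fun j => D j w))]
   = (\sum_S support_prob p (1 - p) S * phi S)%:E)%E.
Proof.
rewrite unlock.
transitivity
  (\int[P]_w (\sum_S (phi S)%:E * (\1_(support_event S) w)%:E))%E.
  apply: eq_integral => w _; rewrite (bigD1 (supp (fun j => D j w))) //=.
  rewrite indicE mem_set // mule1 big1 ?adde0 // => S /eqP SD.
  by rewrite indicE memNset ?mule0 // => /esym.
have indic_int S : P.-integrable setT (fun w => (\1_(support_event S) w)%:E).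
  by apply: integrable_indic; exact: measurable_support_event.
rewrite integral_sum //; last by move=> S; exact: integrableZl.
rewrite -sumEFin; apply: eq_bigr => S _.
rewrite integralZl // integral_indic //; last exact: measurable_support_event.
rewrite setIT mulrC EFinM; congr (_ * _)%E; exact: probability_support_event.
Qed.

End SupportLaw.

Theorem theorem4p1 (R : realType) (disp : measure_display)
    (T : measurableType disp) (P : probability T R)
    (n d : nat) (p q : R) (G : sgraph 'I_n) (D : 'I_n -> {RV P >-> R}) :
  (0 < n)%N ->
  0 < p < 1 ->
  q = 1 - p ->
  avg_degree R G = d%:R ->
  demand_law D p ->
  ((Num.max
      (n%:R * p * q ^+ d - 2^-1 * (1 - (1 - 2 * p) ^+ n))
      (2^-1 * (n%:R * p * q ^+ d) * (1 - (1 - 2 * p) ^+ (n - d - 1)%N)))%:E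
   <= expected_loss D G)%E.
Proof.
move=> n0 p01 qE dE lawD.
(* By conversion, [matching_loss] is [support_loss] evaluated at the support of the demands. *)
rewrite /expected_loss (expectation_support lawD (support_loss R G)) -qE lee_fin.
have V_gt0 : (0 < #|'I_n|)%N by rewrite card_ord.
have := sum_support_loss_ge V_gt0 p01 qE dE.
have := sum_support_loss_parity_ge V_gt0 p01 qE dE.
by rewrite ge_max card_ord => -> ->.
Qed.
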